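(* Let $L$ be an SPS lattice (that is, a slim, planar, semimodular lattice) with more than $2$ elements. Then the congruence lattice $\operatorname{Con} L$ of $L$ has at least two dual atoms.
   Context: A lattice is planar if it is finite and has a planar Hasse diagram (one that can be drawn in the plane, with each covering pair $x \prec y$ drawn as a straight line segment going upward from $x$ to $y$, so that edges meet only at common endpoints). A lattice $L$ is semimodular (upper semimodular) if for all $a, b, c \in L$, whenever $b$ covers $a$, then $b \vee c$ covers or equals $a \vee c$. A planar semimodular lattice is slim if it has no sublattice isomorphic to $\mathsf{M}_3$, the five-element modular non-distributive lattice with a bottom, a top and three pairwise incomparable elements between them. An SPS lattice is a slim, planar, semimodular lattice. $\operatorname{Con} L$ denotes the lattice of all congruence relations of the lattice $L$, ordered by inclusion. A dual atom of a bounded lattice is an element covered by the top element. *)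

(* Defs.v *)
From HB Require Import structures.
From mathcomp Require Import all_boot all_order all_algebra.
From mathcomp Require Import reals.

Set Implicit Arguments.
Unset Strict Implicit.
Unset Printing Implicit Defensive.

Import Order.TTheory GRing.Theory Num.Theory.

Local Open Scope order_scope.

Definition covers d (P : finPOrderType d) (x y : P) : bool :=
  (x < y) && [forall z : P, ~~ (x < z < y)].

Definition dual_atom d (P : finTPOrderType d) (x : P) : bool :=
  covers x \top.

Definition segment (R : realType) (u v q : R * R) : Prop :=
  exists t : R, [/\ (0 <= t <= 1)%R,
    q.1 = ((1 - t) * u.1 + t * v.1)%R & q.2 = ((1 - t) * u.2 + t * v.2)%R].

(* [p x] represents [x], the second coordinate being the height. Edges are
   closed segments: as every vertex of the diagram of a lattice with at least
   two elements lies on an edge, the last clause also forbids an edge to pass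
   through a vertex that is not one of its ends. *)
Definition planar_diagram (R : realType) d (P : finPOrderType d)
    (p : P -> R * R) : Prop :=
  [/\ injective p,
      forall x y : P, covers x y -> ((p x).2 < (p y).2)%R
    & forall x y x' y' : P, covers x y -> covers x' y' ->
        (x, y) != (x', y') ->
        forall q : R * R, segment (p x) (p y) q -> segment (p x') (p y') q ->
        exists v : P, [/\ v \in [:: x; y], v \in [:: x'; y'] & q = p v]].

Definition planar (R : realType) d (P : finPOrderType d) : Prop :=
  exists p : P -> R * R, planar_diagram p.

Definition semimodular d (L : finLatticeType d) : Prop :=
  forall a b c : L, covers a b ->
    covers (a `|` c) (b `|` c) \/ b `|` c = a `|` c.

Variant M3 : Type := M3bot | M3a | M3b | M3c | M3top.

Definition M3_code (x : M3) : 'I_5 :=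
  match x with
  | M3bot => inord 0 | M3a => inord 1 | M3b => inord 2 | M3c => inord 3
  | M3top => inord 4
  end.

Definition M3_decode (i : 'I_5) : M3 :=
  nth M3bot [:: M3bot; M3a; M3b; M3c; M3top] i.

Lemma M3_codeK : cancel M3_code M3_decode.
Proof. by case; rewrite /M3_decode inordK. Qed.

HB.instance Definition _ := Finite.copy M3 (can_type M3_codeK).

Definition M3_le (x y : M3) : bool := [|| x == M3bot, y == M3top | x == y].

Definition M3_meet (x y : M3) : M3 :=
  if M3_le x y then x else if M3_le y x then y else M3bot.

Definition M3_join (x y : M3) : M3 :=
  if M3_le x y then y else if M3_le y x then x else M3top.

Lemma M3_eqE (x y : M3) : (x == y) = (match x, y with
  | M3bot, M3bot | M3a, M3a | M3b, M3b | M3c, M3c | M3top, M3top => true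
  | _, _ => false end).
Proof. by apply/eqP/idP; [move=> ->; case: y | case: x; case: y]. Qed.

Lemma M3_le_refl : reflexive M3_le.
Proof. by move=> x; rewrite /M3_le eqxx !orbT. Qed.

Lemma M3_le_anti : antisymmetric M3_le.
Proof. by case; case; rewrite /M3_le !M3_eqE. Qed.

Lemma M3_le_trans : transitive M3_le.
Proof. by case; case; case; rewrite /M3_le !M3_eqE. Qed.

Fact M3_display : Order.disp_t. Proof. exact: Order.Disp tt tt. Qed.

HB.instance Definition _ :=
  Order.Le_isPOrder.Build M3_display M3 M3_le_refl M3_le_anti M3_le_trans.

Lemma M3_lexI (x y z : M3) : (x <= M3_meet y z) = (x <= y) && (x <= z).
Proof.
by case: x; case: y; case: z;
  rewrite /M3_meet /Order.le /= /M3_le /= !M3_eqE.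
Qed.

Lemma M3_leUx (x y z : M3) : (M3_join x y <= z) = (x <= z) && (y <= z).
Proof.
by case: x; case: y; case: z;
  rewrite /M3_join /Order.le /= /M3_le /= !M3_eqE.
Qed.

HB.instance Definition _ :=
  Order.POrder_isMeetSemilattice.Build M3_display M3 M3_lexI.
HB.instance Definition _ :=
  Order.POrder_isJoinSemilattice.Build M3_display M3 M3_leUx.

Definition is_sublattice d (L : finLatticeType d) (S : {set L}) : Prop :=
  forall x y : L, x \in S -> y \in S -> x `&` y \in S /\ x `|` y \in S.

(* [f], with codomain restricted to its image [S], is the isomorphism. *)
Definition has_sublattice_iso d (L : finLatticeType d)
    d' (K : finLatticeType d') : Prop :=
  exists S : {set L}, is_sublattice S /\
    exists f : {lmorphism K -> L}, injective f /\ f @: [set: K] = S.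

Definition slim d (L : finLatticeType d) : Prop :=
  ~ has_sublattice_iso L M3.

Definition SPS (R : realType) d (L : finLatticeType d) : Prop :=
  [/\ slim L, planar R L & semimodular L].

Definition is_congruence d (L : finLatticeType d) (theta : {set L * L}) : bool :=
  [&& [forall x, (x, x) \in theta],
      [forall x, forall y, ((x, y) \in theta) ==> ((y, x) \in theta)],
      [forall x, forall y, forall z,
        ((x, y) \in theta) && ((y, z) \in theta) ==> ((x, z) \in theta)]
    & [forall p in theta, forall q in theta,
        ((p.1 `&` q.1, p.2 `&` q.2) \in theta)
        && ((p.1 `|` q.1, p.2 `|` q.2) \in theta)]].

Lemma is_congruenceP d (L : finLatticeType d) (theta : {set L * L}) :
  reflect
    [/\ forall x, (x, x) \in theta,
        forall x y, (x, y) \in theta -> (y, x) \in theta,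
        forall x y z, (x, y) \in theta -> (y, z) \in theta -> (x, z) \in theta
      & forall x y x' y', (x, y) \in theta -> (x', y') \in theta ->
        (x `&` x', y `&` y') \in theta /\ (x `|` x', y `|` y') \in theta]
    (is_congruence theta).
Proof.
apply: (iffP and4P) => -[r s t c]; split.
- exact/forallP.
- by move=> x y; move/forallP/(_ x)/forallP/(_ y)/implyP: s.
- move=> x y z xy yz.
  by move/forallP/(_ x)/forallP/(_ y)/forallP/(_ z): t; rewrite xy yz.
- move=> x y x' y' h h'; apply/andP.
  by move/forall_inP/(_ _ h)/forall_inP/(_ _ h'): c.
- exact/forallP.
- by apply/forallP=> x; apply/forallP=> y; apply/implyP/s.
- apply/forallP=> x; apply/forallP=> y; apply/forallP=> z.
  by apply/implyP=> /andP[]; apply: t.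
- apply/forall_inP=> -[x y] h; apply/forall_inP=> -[x' y'] h' /=.
  exact/andP/c.
Qed.

(* Congruences are encoded as subsets of [L * L]. *)
Record con d (L : finLatticeType d) : Type := Con {
  con_set :> {set L * L};
  con_setP : is_congruence con_set
}.

HB.instance Definition _ d (L : finLatticeType d) :=
  [isSub for @con_set d L].
HB.instance Definition _ d (L : finLatticeType d) :=
  [Finite of con L by <:].

Definition con_le d (L : finLatticeType d) (s t : con L) : bool :=
  con_set s \subset con_set t.

Lemma con_le_refl d (L : finLatticeType d) : reflexive (@con_le d L).
Proof. by move=> s; apply: subxx. Qed.

Lemma con_le_anti d (L : finLatticeType d) : antisymmetric (@con_le d L).
Proof. by move=> s t st; apply/val_inj/eqP; rewrite eqEsubset. Qed.

Lemma con_le_trans d (L : finLatticeType d) : transitive (@con_le d L).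
Proof. by move=> t s u; apply: subset_trans. Qed.

Fact con_display : Order.disp_t. Proof. exact: Order.Disp tt tt. Qed.

HB.instance Definition _ d (L : finLatticeType d) :=
  Order.Le_isPOrder.Build con_display (con L)
    (@con_le_refl d L) (@con_le_anti d L) (@con_le_trans d L).

Lemma con_leE d (L : finLatticeType d) (s t : con L) :
  (s <= t) = (con_set s \subset con_set t).
Proof. by []. Qed.

Lemma bigcap_congruence d (L : finLatticeType d) (P : pred (con L)) :
  is_congruence (\bigcap_(s | P s) con_set s).
Proof.
apply/is_congruenceP; split.
- by move=> x; apply/bigcapP=> s _; case/is_congruenceP: (con_setP s).
- move=> x y /bigcapP h; apply/bigcapP=> s Ps.
  by case/is_congruenceP: (con_setP s) => _ sym _ _; apply/sym/h.
- move=> x y z /bigcapP h /bigcapP h'; apply/bigcapP=> s Ps.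
  by case/is_congruenceP: (con_setP s) => _ _ tr _; apply: tr (h s Ps) (h' s Ps).
- move=> x y x' y' /bigcapP h /bigcapP h'.
  by split; apply/bigcapP=> s Ps;
    case/is_congruenceP: (con_setP s) => _ _ _ /(_ _ _ _ _ (h s Ps) (h' s Ps)) [].
Qed.

Definition con_bigcap d (L : finLatticeType d) (P : pred (con L)) : con L :=
  Con (bigcap_congruence P).

Definition con_meet d (L : finLatticeType d) (s t : con L) : con L :=
  con_bigcap (pred2 s t).

Definition con_join d (L : finLatticeType d) (s t : con L) : con L :=
  con_bigcap [pred u : con L | (s <= u) && (t <= u)].

Lemma con_lexI d (L : finLatticeType d) (s t u : con L) :
  (s <= con_meet t u) = (s <= t) && (s <= u).
Proof.
rewrite !con_leE; apply/bigcapsP/andP => [h | [st su] v].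
  by split; apply: h; rewrite /= eqxx ?orbT.
by case/orP=> /eqP->.
Qed.

Lemma con_leUx d (L : finLatticeType d) (s t u : con L) :
  (con_join s t <= u) = (s <= u) && (t <= u).
Proof.
apply/idP/idP => [h | h]; last by rewrite con_leE; apply: bigcap_inf.
by apply/andP; split; apply: le_trans h; rewrite con_leE;
  apply/bigcapsP=> v /andP[].
Qed.

Lemma con_full d (L : finLatticeType d) : is_congruence [set: L * L].
Proof. by apply/is_congruenceP; split=> *; rewrite ?inE. Qed.

Lemma con_diag d (L : finLatticeType d) :
  is_congruence [set p : L * L | p.1 == p.2].
Proof.
apply/is_congruenceP; split.
- by move=> x; rewrite inE.
- by move=> x y; rewrite !inE eq_sym.
- by move=> x y z; rewrite !inE /= => /eqP-> /eqP->.
- by move=> x y x' y'; rewrite !inE /= => /eqP-> /eqP->.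
Qed.

Lemma con_le_full d (L : finLatticeType d) (s : con L) : s <= Con (con_full L).
Proof. by rewrite con_leE subsetT. Qed.

Lemma con_ge_diag d (L : finLatticeType d) (s : con L) : Con (con_diag L) <= s.
Proof.
rewrite con_leE; apply/subsetP=> -[x y]; rewrite inE /= => /eqP->.
by case/is_congruenceP: (con_setP s).
Qed.

HB.instance Definition _ d (L : finLatticeType d) :=
  Order.POrder_isMeetSemilattice.Build con_display (con L) (@con_lexI d L).
HB.instance Definition _ d (L : finLatticeType d) :=
  Order.POrder_isJoinSemilattice.Build con_display (con L) (@con_leUx d L).
HB.instance Definition _ d (L : finLatticeType d) :=
  Order.hasBottom.Build con_display (con L) (@con_ge_diag d L).
HB.instance Definition _ d (L : finLatticeType d) :=
  Order.hasTop.Build con_display (con L) (@con_le_full d L).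

(* Main.v *)
Require Import Defs.
From HB Require Import structures.
From mathcomp Require Import all_boot all_order all_algebra.
From mathcomp Require Import reals.
From mathcomp Require Import lra ring.

Set Implicit Arguments.
Unset Strict Implicit.
Unset Printing Implicit Defensive.

Import Order.TTheory GRing.Theory Num.Theory.

Local Open Scope order_scope.

(** A join-prime element [p] that is not the bottom splits [L] into the prime
    filter above [p] and a prime ideal, which gives a congruence with exactly two
    blocks, hence a dual atom of [Con L]. So it suffices to find two of them.

    Every element of an SPS lattice has at most two covers: if [b], [c], [e]
    cover [a] and leave it in this order from left to right, then a path going
    up from [c] can leave the region enclosed by the quadrangle [a], [b],
    [b `|` e], [e] only through [b `|` e], so [c <= b `|` e]. By semimodularity
    the three pairwise joins then coincide, and [a], [b], [c], [e], [b `|` e] form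
    a copy of M3.

    Consequently a cover of an element comparable to all others is join-prime.
    This applies to the atoms, and, when there is only one atom, also to the
    covers of that atom. *)

(** * Covers and least elements in finite orders *)

Lemma covers_lt d (P : finPOrderType d) (x y : P) : covers x y -> x < y.
Proof. by case/andP. Qed.

Lemma covers_between d (P : finPOrderType d) (x y z : P) :
  covers x y -> x < z -> z <= y -> z = y.
Proof.
case/andP=> _ /forallP/(_ z) + xz zy; rewrite xz /=.
by rewrite lt_neqAle zy andbT negbK => /eqP.
Qed.

Lemma covers_eq d (P : finPOrderType d) (x y z : P) :
  covers x y -> covers x z -> y <= z -> y = z.
Proof. by move=> xy xz; apply: (covers_between xz (covers_lt xy)). Qed.

(** Among the elements strictly above [x] and at most [z], one with the smallest down-set covers
    [x]. *)
Lemma covers_below d (P : finPOrderType d) (x z : P) :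
  x < z -> exists2 y, covers x y & y <= z.
Proof.
move=> xz.
have Pz : (x < z) && (z <= z) by rewrite xz lexx.
pose down (y : P) := #|[set w : P | w <= y]|.
case: (@arg_minnP P z (fun y => (x < y) && (y <= z)) down Pz).
move=> y /andP[xy yz] ymin.
exists y => //; rewrite /covers xy; apply/forallP=> w; apply/negP=> /andP[xw wy].
have := ymin w; rewrite xw (le_trans (ltW wy) yz) => /(_ isT).
rewrite leqNgt => /negP; apply; apply: proper_card; apply/properP; split.
  by apply/subsetP=> v; rewrite !inE => /le_trans; apply; apply: ltW.
by exists y; rewrite inE ?lexx // lt_geF.
Qed.

(** An element [o] with the smallest down-set is least: [o] meet [x] cannot have a smaller one. The
    argument [x0] ensures that [L] is nonempty. *)
Lemma finLattice_bottom d (L : finLatticeType d) (x0 : L) :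
  exists o : L, forall x, o <= x.
Proof.
pose down (y : L) := #|[set w : L | w <= y]|.
case: (@arg_minnP L x0 predT down isT) => o _ omin; exists o => x.
have := omin (o `&` x) isT; rewrite leqNgt => /negP nlt.
have: o `&` x <= o by rewrite leIl.
rewrite le_eqVlt => /orP[/eqP <-|lt]; first exact: leIr.
case: nlt; apply: proper_card; apply/properP; split.
  by apply/subsetP=> v; rewrite !inE => /le_trans; apply; apply: leIl.
by exists o; rewrite inE ?lexx // lt_geF.
Qed.

(** * Join-prime elements and dual atoms of the congruence lattice *)

Definition join_prime d (L : latticeType d) (p : L) : Prop :=
  forall a b : L, (p <= a `|` b) = (p <= a) || (p <= b).

(** For join-prime [p] this is the kernel of the homomorphism to the two-element chain that sends
    exactly the elements above [p] to the top. *)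
Definition filter_rel d (L : finLatticeType d) (p : L) : {set L * L} :=
  [set u | (p <= u.1) == (p <= u.2)].

Lemma filter_rel_congruence d (L : finLatticeType d) (p : L) :
  join_prime p -> is_congruence (filter_rel p).
Proof.
move=> pp; apply/is_congruenceP; split.
- by move=> x; rewrite inE.
- by move=> x y; rewrite !inE eq_sym.
- by move=> x y z; rewrite !inE /= => /eqP-> /eqP->.
- by move=> x y x' y'; rewrite !inE /= !lexI !pp => /eqP-> /eqP->.
Qed.

(** A strictly larger congruence identifies some [x] and [y] from different blocks. Every element
    shares its block with one of the two, so everything is identified. The element [q] makes the
    second block nonempty. *)
Lemma filter_rel_dual_atom d (L : finLatticeType d) (p q : L) (pp : join_prime p) :
  ~~ (p <= q) -> dual_atom (Con (filter_rel_congruence pp)).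
Proof.
set th := Con _ => pq; apply/andP; split.
  rewrite lt_neqAle lex1 andbT; apply/eqP=> E.
  have: (p, q) \in con_set th by rewrite E inE.
  by rewrite inE /= lexx (negbTE pq).
apply/forallP=> z; apply/negP=> /andP[]; rewrite lt_leAnge con_leE => /andP[thz].
rewrite con_leE => /subsetPn[[x y] xyz].
case/is_congruenceP: (con_setP z) => zr zs zt _.
have all2 u v : u \in [:: x; y] -> v \in [:: x; y] -> (u, v) \in con_set z.
  by rewrite !inE => /orP[]/eqP-> /orP[]/eqP-> //; apply: zs.
rewrite inE /= => ne /lt_geF/negP; apply; rewrite con_leE; apply/subsetP=> -[u v] _.
have rep w : exists2 w', w' \in [:: x; y] & (w, w') \in con_set z.
  have: ((p <= w) == (p <= x)) || ((p <= w) == (p <= y)).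
    by move: ne; case: (p <= w); case: (p <= x); case: (p <= y).
  case/orP=> e; [exists x | exists y]; rewrite ?inE ?eqxx ?orbT //;
    by apply: (subsetP thz); rewrite inE.
have [[u' hu uu'] [v' hv vv']] := (rep u, rep v).
exact: zt uu' (zt _ _ _ (all2 _ _ hu hv) (zs _ _ vv')).
Qed.

Lemma two_dual_atoms d (L : finLatticeType d) (p q p' q' : L) :
  join_prime p -> join_prime q -> ~~ (p <= p') -> ~~ (q <= q') -> p != q ->
  (2 <= #|[set theta : con L | dual_atom theta]|)%N.
Proof.
move=> pp pq hp hq npq; set S := [set _ | _].
have mp : Con (filter_rel_congruence pp) \in S.
  by rewrite inE (filter_rel_dual_atom pp hp).
have mq : Con (filter_rel_congruence pq) \in S.
  by rewrite inE (filter_rel_dual_atom pq hq).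
apply/card_gt1P; exists (Con (filter_rel_congruence pp)).
exists (Con (filter_rel_congruence pq)); split=> //.
apply/eqP=> /(congr1 (@con_set d L)) /= E.
have memE x y : ((p <= x) == (p <= y)) = ((q <= x) == (q <= y)).
  by have := congr1 (fun s : {set L * L} => (x, y) \in s) E; rewrite !inE.
(* The element [p'] meet [q'] is above neither [p] nor [q]. Comparing it with [p] and with [q] in
   the common congruence gives [q <= p] and [p <= q]. *)
have hpI : ~~ (p <= p' `&` q') by rewrite lexI (negbTE hp).
have hqI : ~~ (q <= p' `&` q') by rewrite lexI (negbTE hq) andbF.
have := memE p (p' `&` q'); have := memE q (p' `&` q').
rewrite !lexx (negbTE hpI) (negbTE hqI) !eqbF_neg /= => /negbFE pq'.
move/esym/negbFE=> qp'.
by move/eqP: npq; apply; apply: le_anti; rewrite pq' qp'.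
Qed.

(** * Recognizing a copy of [M3] *)

Definition M3_fun (T : Type) (o a b c t : T) (x : M3) : T :=
  match x with M3bot => o | M3a => a | M3b => b | M3c => c | M3top => t end.

Lemma M3_in_lattice d (L : finLatticeType d) (o a b c t : L) :
  o < a -> o < b -> o < c ->
  a `&` b = o -> a `&` c = o -> b `&` c = o ->
  a `|` b = t -> a `|` c = t -> b `|` c = t ->
  has_sublattice_iso L M3.
Proof.
move=> oa ob oc ab ac bc jab jac jbc.
pose f := M3_fun o a b c t.
have [la lb lc] : [/\ a <= t, b <= t & c <= t].
  by split; [rewrite -jab leUl | rewrite -jab leUr | rewrite -jac leUr].
have lo : o <= t by apply: le_trans la; apply: ltW.
have fI x y : f (x `&` y) = f x `&` f y.
  rewrite -[x `&` y]/(M3_meet x y) /M3_meet /M3_le !M3_eqE.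
  case: x; case: y; rewrite /f /= ?meetxx ?ab ?ac ?bc //;
    rewrite ?[b `&` a]meetC ?[c `&` a]meetC ?[c `&` b]meetC ?ab ?ac ?bc //;
    symmetry; first [apply/meet_idPl | apply/meet_idPr]; by [|apply: ltW].
have fU x y : f (x `|` y) = f x `|` f y.
  rewrite -[x `|` y]/(M3_join x y) /M3_join /M3_le !M3_eqE.
  case: x; case: y; rewrite /f /= ?joinxx ?jab ?jac ?jbc //;
    rewrite ?[b `|` a]joinC ?[c `|` a]joinC ?[c `|` b]joinC ?jab ?jac ?jbc //;
    symmetry; first [apply/join_idPl | apply/join_idPr]; by [|apply: ltW].
have fle x y : x <= y -> f x <= f y.
  by move=> /meet_idPl xy; apply/meet_idPl; rewrite -fI xy.
have finj : injective f.
  have fneq x y : f x `&` f y = o -> o < f x -> f x <> f y.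
    by move=> + + E; rewrite -E meetxx => ->; rewrite ltxx.
  have ftop x y : f x `|` f y = t -> f x `&` f y = o -> o < f y -> f x <> t.
    move=> xyt xyo oy xt; have: f y <= f x by rewrite xt -xyt leUr.
    by move/meet_idPr; rewrite xyo => oE; rewrite oE ltxx in oy.
  have [aM bM cM] : [/\ a <> t, b <> t & c <> t].
    split; [exact: (ftop M3a M3b) | apply: (ftop M3b M3c) => // | ].
    by apply: (ftop M3c M3a) => //=; rewrite ?[c `|` a]joinC ?[c `&` a]meetC.
  have oM : o < t by apply: lt_le_trans la.
  have [nab nac nbc] : [/\ a <> b, a <> c & b <> c].
    by split; [exact: (fneq M3a M3b) | exact: (fneq M3a M3c) | exact: (fneq M3b M3c)].
  by case; case=> //= /esym e //; exfalso;
    move: oa ob oc oM nab nac nbc aM bM cM; rewrite ?e ?ltxx.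
pose g : {lmorphism M3 -> L} := HB.pack f
  (Order.isOrderMorphism.Build _ _ _ _ f fle)
  (Order.isMeetLatticeMorphism.Build _ _ _ _ f fI)
  (Order.isJoinLatticeMorphism.Build _ _ _ _ f fU).
exists (f @: [set: M3]); split; last by exists g.
move=> _ _ /imsetP[x _ ->] /imsetP[y _ ->].
by rewrite -fI -fU !imset_f.
Qed.

(** * Edges as affine functions of the height *)

Local Open Scope ring_scope.

(** The abscissa, at height [h], of the line through [u] and [v]. *)
Definition xat (R : realType) (u v : R * R) (h : R) : R :=
  u.1 + (h - u.2) / (v.2 - u.2) * (v.1 - u.1).

Lemma segment_xat (R : realType) (u v : R * R) (h : R) :
  u.2 < v.2 -> u.2 <= h <= v.2 -> segment u v (xat u v h, h).
Proof.
move=> uv /andP[uh hv]; exists ((h - u.2) / (v.2 - u.2)).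
have uv0 : 0 < v.2 - u.2 by lra.
split; rewrite /xat /=.
- by rewrite divr_ge0 ?ler_pdivrMr //=; lra.
- by ring.
- by field; lra.
Qed.

Lemma xat_affine (R : realType) (u v : R * R) : exists al be : R,
  forall h, xat u v h = al + be * h.
Proof.
exists (u.1 - u.2 / (v.2 - u.2) * (v.1 - u.1)), ((v.1 - u.1) / (v.2 - u.2)).
by move=> h; rewrite /xat; ring.
Qed.

Lemma xat_cross (R : realType) (u v u' v' : R * R) (h0 h1 : R) :
  h0 <= h1 -> xat u v h0 < xat u' v' h0 -> xat u' v' h1 <= xat u v h1 ->
  exists2 h, h0 <= h <= h1 & xat u v h = xat u' v' h.
Proof.
have [al [be E]] := xat_affine u v; have [al' [be' E']] := xat_affine u' v'.
rewrite !E !E' => h01 lt0 ge1.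
pose D0 := (al' - al) + (be' - be) * h0; pose D1 := (al' - al) + (be' - be) * h1.
have D0p : 0 < D0 by rewrite /D0; lra.
have D1n : D1 <= 0 by rewrite /D1; lra.
have D01 : 0 < D0 - D1 by lra.
(* The difference of the two abscissas is affine, with values [D0] and [D1] at [h0] and [h1]; it
   vanishes at the fraction [q] of the way. *)
pose q := D0 / (D0 - D1).
have qE : q * (D0 - D1) = D0 by rewrite /q divfK ?gt_eqF.
have q0 : 0 <= q by apply: divr_ge0; lra.
have q1 : q <= 1 by rewrite ler_pdivrMr //; lra.
exists (h0 + q * (h1 - h0)); first by apply/andP; split; nra.
by rewrite !E !E'; move: qE; rewrite /D0 /D1; clear; nra.
Qed.

(* Meaningful for heights between those of [x] and [last x s] only; at the height of
   a vertex both adjacent edges give the same value. *)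
Fixpoint path_xat (R : realType) (T : Type) (p : T -> R * R) (x : T) (s : seq T)
    (h : R) : R :=
  if s is y :: s' then
    if h <= (p y).2 then xat (p x) (p y) h else path_xat p y s' h
  else (p x).1.

Lemma xat_start (R : realType) (u v : R * R) : xat u v u.2 = u.1.
Proof. by rewrite /xat subrr !mul0r addr0. Qed.

Lemma xat_end (R : realType) (u v : R * R) : u.2 < v.2 -> xat u v v.2 = v.1.
Proof. by move=> uv; rewrite /xat divff ?mul1r; lra. Qed.

(** * Left-to-right order of upward paths in a planar diagram *)

Section Diagram.

Context (R : realType) d (P : finPOrderType d) (p : P -> R * R).
Context (dp : planar_diagram p).

Let up x y : covers x y -> (p x).2 < (p y).2.
Proof. by case: dp => _ + _; apply. Qed.

Lemma path_xat_start x s :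
  path (@covers d P) x s -> path_xat p x s (p x).2 = (p x).1.
Proof. by case: s => //= y s /andP[/up/ltW-> _]; rewrite xat_start. Qed.

Lemma path_up x s : path (@covers d P) x s -> (p x).2 <= (p (last x s)).2.
Proof.
elim: s x => //= y s IH x /andP[/up xy /IH]; apply: le_trans; exact: ltW.
Qed.

Lemma path_xat_last x s :
  path (@covers d P) x s -> path_xat p x s (p (last x s)).2 = (p (last x s)).1.
Proof.
elim: s x => //= y s IH x /andP[/up xy ys]; case: ifP => [hle|_]; last exact: IH.
have e : (p y).2 = (p (last y s)).2 by apply/le_anti; rewrite hle path_up.
by rewrite -e xat_end // -(path_xat_start ys) e IH.
Qed.

Lemma path_xat_after x y s h : path (@covers d P) x (y :: s) -> (p y).2 <= h ->
  path_xat p x (y :: s) h = path_xat p y s h.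
Proof.
move=> /= /andP[/up xy ys]; rewrite le_eqVlt => /orP[/eqP<-|/lt_geF->//].
by rewrite lexx xat_end // path_xat_start.
Qed.

Lemma xat_meet x y x' y' h : covers x y -> covers x' y' -> (x, y) != (x', y') ->
  (p x).2 <= h <= (p y).2 -> (p x').2 <= h <= (p y').2 ->
  xat (p x) (p y) h = xat (p x') (p y') h ->
  exists v, [/\ v \in [:: x; y], v \in [:: x'; y'] & (p v).2 = h].
Proof.
move=> xy x'y' ne hr hr' E; have [_ _ nc] := dp.
have s1 := segment_xat (up xy) hr.
have s2 := segment_xat (up x'y') hr'; rewrite -E in s2.
have [v [v1 v2 e]] := nc _ _ _ _ xy x'y' ne _ s1 s2.
by exists v; split=> //; rewrite -e.
Qed.

(** A change of order would force a crossing at a height of at least [h0], hence a shared vertex at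
    that height, while all shared vertices are below [h0]. *)
Lemma edge_lt x y x' y' h0 h1 : covers x y -> covers x' y' ->
  (p x).2 <= h0 -> (p x').2 <= h0 -> h0 <= h1 ->
  h1 <= (p y).2 -> h1 <= (p y').2 ->
  (forall v, v \in [:: x; y] -> v \in [:: x'; y'] -> (p v).2 < h0) ->
  xat (p x) (p y) h0 < xat (p x') (p y') h0 ->
  xat (p x) (p y) h1 < xat (p x') (p y') h1.
Proof.
move=> xy x'y' xh xh' h01 hy hy' shared lt0; rewrite ltNge; apply/negP=> ge1.
have [h /andP[h0h hh1] E] := xat_cross h01 lt0 ge1.
have ne : (x, y) != (x', y').
  apply/eqP=> -[ex ey]; have := shared y; rewrite -ex -ey !inE eqxx orbT.
  by move=> /(_ isT isT); lra.
case: (@xat_meet x y x' y' h) => //; [lra | lra | move=> v [v1 v2 hv]].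
by have := shared v v1 v2; lra.
Qed.

(** Induction on the total length: [edge_lt] carries the order up to the lower of the two first
    upper ends, where that edge is dropped and the argument restarts. Hence [h0] is general in the
    induction. *)
Lemma path_xat_lt x s x' s' h0 h1 :
  path (@covers d P) x s -> path (@covers d P) x' s' ->
  (p x).2 <= h0 -> (p x').2 <= h0 -> h0 <= h1 ->
  h1 <= (p (last x s)).2 -> h1 <= (p (last x' s')).2 ->
  (forall v, v \in x :: s -> v \in x' :: s' -> (p v).2 < h0) ->
  path_xat p x s h0 < path_xat p x' s' h0 ->
  path_xat p x s h1 < path_xat p x' s' h1.
Proof.
have [n] := ubnP (size s + size s'); elim: n x s x' s' h0 => // n IH.
move=> x [|y s] x' [|y' s'] h0 //= szn.
(* A path without edges leaves no room above its vertex, so [h0] and [h1] coincide. *)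
- by move=> _ _ xh _ h01 hl _ _; rewrite (@le_anti _ _ h1 h0) ?h01 ?(le_trans hl xh).
- by move=> _ _ _ xh h01 _ hl _; rewrite (@le_anti _ _ h1 h0) ?h01 ?(le_trans hl xh).
rewrite -!/(path_xat p x (y :: s) _) -!/(path_xat p x' (y' :: s') _).
move=> xs xs' xh xh' h01 hl hl' shared lt0.
have [xy ys] := andP xs; have [x'y' ys'] := andP xs'.
have stepl h : h0 <= h -> h <= h1 -> (p y).2 <= h ->
    path_xat p x (y :: s) h < path_xat p x' (y' :: s') h ->
    path_xat p x (y :: s) h1 < path_xat p x' (y' :: s') h1.
  move=> h0h hh1 yh; rewrite !(path_xat_after xs) // ?(le_trans yh) // => lth.
  apply: (IH y s x' (y' :: s') h) => //=; try lra.
  by move=> v vs vs'; apply: lt_le_trans h0h; apply: shared; rewrite // inE vs orbT.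
have stepr h : h0 <= h -> h <= h1 -> (p y').2 <= h ->
    path_xat p x (y :: s) h < path_xat p x' (y' :: s') h ->
    path_xat p x (y :: s) h1 < path_xat p x' (y' :: s') h1.
  move=> h0h hh1 yh; rewrite !(path_xat_after xs') // ?(le_trans yh) // => lth.
  apply: (IH x (y :: s) y' s' h) => //=; try lra.
    by rewrite addnS in szn.
  by move=> v vs vs'; apply: lt_le_trans h0h; apply: shared; rewrite // inE vs' orbT.
have [h0y|/ltW yh0] := leP h0 (p y).2; last exact: (stepl h0).
have [h0y'|/ltW yh0] := leP h0 (p y').2; last exact: (stepr h0).
have lt_upto h : h0 <= h -> h <= (p y).2 -> h <= (p y').2 ->
    path_xat p x (y :: s) h < path_xat p x' (y' :: s') h.
  move=> h0h hy hy'; move: lt0; rewrite /= h0y h0y' hy hy'.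
  apply: edge_lt => // v v1 v2; apply: shared.
    by move: v1; rewrite !inE => /orP[]->; rewrite ?orbT.
  by move: v2; rewrite !inE => /orP[]->; rewrite ?orbT.
have [h1y|/ltW yh1] := leP h1 (p y).2; have [h1y'|/ltW yh1'] := leP h1 (p y').2.
- exact: lt_upto.
- by apply: (stepr (p y').2) => //; apply: lt_upto => //; lra.
- by apply: (stepl (p y).2) => //; apply: lt_upto => //; lra.
have [yy'|/ltW yy'] := leP (p y).2 (p y').2.
- by apply: (stepl (p y).2) => //; apply: lt_upto.
- by apply: (stepr (p y').2) => //; apply: lt_upto.
Qed.

End Diagram.

Local Close Scope ring_scope.

(** * Covers in slim planar semimodular lattices *)

Lemma semimodular_covers d (L : finLatticeType d) (a b c : L) :
  semimodular L -> covers a b -> a <= c -> ~~ (b <= c) -> covers c (b `|` c).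
Proof.
move=> sm ab /join_idPr ac nbc; case: (sm a b c ab); rewrite ac // => /join_idPr.
by rewrite (negbTE nbc).
Qed.

Lemma covers_nle d (P : finPOrderType d) (a b c : P) :
  covers a b -> covers a c -> b != c -> ~~ (b <= c).
Proof. by move=> ab ac; apply: contraNN => bc; apply/eqP; apply: (covers_eq ab ac). Qed.

(** Otherwise the path [a], [c], [u], [t] shares only [a] with the paths from [a] to [v] through [b]
    and through [e], and starts between them. At the height of [v] it would be strictly right of [v]
    and strictly left of it. *)
Lemma middle_cover_le d (L : finLatticeType d) (R : realType) (p : L -> R * R)
    (a b c e : L) (h : R) :
  semimodular L -> planar_diagram p ->
  covers a b -> covers a c -> covers a e ->
  ((p a).2 < h)%R -> (h <= (p b).2)%R -> (h <= (p c).2)%R -> (h <= (p e).2)%R ->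
  (xat (p a) (p b) h < xat (p a) (p c) h)%R ->
  (xat (p a) (p c) h < xat (p a) (p e) h)%R ->
  c <= b `|` e.
Proof.
move=> sm dp ab ac ae ah hb hc he ltbc ltce; apply/negPn/negP=> ncv.
have nbc : b != c by apply: contraTneq ltbc => ->; rewrite ltxx.
have nce : c != e by apply: contraTneq ltce => ->; rewrite ltxx.
have nbe : b != e by apply: contraTneq (lt_trans ltbc ltce) => ->; rewrite ltxx.
pose v := b `|` e; pose u := b `|` c; pose t := e `|` u.
have [la lb lc] : [/\ a <= b, a <= c & a <= e].
  by split; apply/ltW/covers_lt.
have bv : covers b v.
  rewrite /v joinC; apply: (semimodular_covers sm ae) => //.
  by rewrite (covers_nle ae ab) // eq_sym.
have ev : covers e v by apply: (semimodular_covers sm ab) => //; apply: (covers_nle ab ae).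
have cu : covers c u by apply: (semimodular_covers sm ab) => //; apply: (covers_nle ab ac).
have nvu : v != u by apply: contraNneq ncv; rewrite /v => ->; rewrite leUr.
have ut : covers u t.
  apply: (semimodular_covers sm ae); first by rewrite (le_trans la) ?leUl.
  (* If [e <= u], then [u] and [v] are comparable covers of [b], hence equal. *)
  apply/negP=> eu; have vu : v <= u by rewrite leUx leUl.
  have bu : covers b u.
    rewrite /u joinC; apply: (semimodular_covers sm ac) => //.
    by rewrite (covers_nle ac ab) // eq_sym.
  by case/eqP: nvu; apply: covers_eq bv bu vu.
(* This puts [t] higher than [v], so the middle path does reach the height of [v]. *)
have vt : covers v t.
  have -> : t = c `|` v by rewrite /t /u /v joinA joinC [e `|` b]joinC.
  by apply: (semimodular_covers sm ac) => //; rewrite (le_trans la) ?leUl.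
have up x y : covers x y -> ((p x).2 < (p y).2)%R by case: dp => _ + _; apply.
have [hbv hev hvt] := And3 (up _ _ bv) (up _ _ ev) (up _ _ vt).
have side x : covers a x -> covers x v -> (h <= (p x).2)%R ->
    path (@covers d L) a [:: x; v] /\ path_xat p a [:: x; v] h = xat (p a) (p x) h.
  by move=> ax xv hx; rewrite /= ax xv hx.
have mid : path (@covers d L) a [:: c; u; t] by rewrite /= ac cu ut.
have midh : path_xat p a [:: c; u; t] h = xat (p a) (p c) h by rewrite /= hc.
(* Past [a], the middle path stays above [c], whereas the side paths stay below [v]. *)
have shared x : x <= v -> covers a x ->
    forall w, w \in [:: a; x; v] -> w \in [:: a; c; u; t] -> ((p w).2 < h)%R.
  move=> xv ax w wv; rewrite inE => /orP[/eqP->//|wc].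
  have lcw : c <= w.
    move: wc; rewrite !inE => /or3P[]/eqP-> //; first exact: leUr.
    by rewrite /t /u joinA leUr.
  have lwv : w <= v.
    by move: wv; rewrite !inE => /or3P[]/eqP->; rewrite // (le_trans la) ?leUl.
  by move: ncv; rewrite (le_trans lcw lwv).
have [pb eb] := side b ab bv hb; have [pe ee] := side e ae ev he.
have hv : (h <= (p v).2)%R by lra.
have := path_xat_lt dp pb mid (ltW ah) (ltW ah) hv (lexx _) (ltW hvt)
  (shared b (leUl _ _) ab).
rewrite eb midh => /(_ ltbc) lt1.
have := path_xat_lt dp mid pe (ltW ah) (ltW ah) hv (ltW hvt) (lexx _)
  (fun w wm we => shared e (leUr _ _) ae w we wm).
rewrite ee midh => /(_ ltce) lt2.
by move: lt1 lt2; rewrite (path_xat_last dp pb) (path_xat_last dp pe) /=; lra.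
Qed.

(** By semimodularity each pairwise join covers both of its arguments. As [c] is below [b] join [e],
    the other two joins are below it as well, and comparable covers of one element are equal. *)
Lemma M3_of_three_covers d (L : finLatticeType d) (a b c e : L) :
  semimodular L -> covers a b -> covers a c -> covers a e ->
  b != c -> b != e -> c != e -> c <= b `|` e -> has_sublattice_iso L M3.
Proof.
move=> sm ab ac ae nbc nbe nce cbe.
have meet x y : covers a x -> covers a y -> x != y -> x `&` y = a.
  move=> ax ay nxy; apply/esym/eqP; apply/negPn/negP=> ne.
  have lt : a < x `&` y.
    by rewrite lt_neqAle ne lexI !ltW ?covers_lt.
  case/eqP: nxy; rewrite -(covers_between ax lt (leIl _ _)).
  exact: covers_between ay lt (leIr _ _).
have cov x y : covers a x -> covers a y -> x != y -> covers x (x `|` y).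
  move=> ax ay nxy; rewrite joinC; apply: (semimodular_covers sm ay).
    exact/ltW/covers_lt.
  by apply: (covers_nle ay ax); rewrite eq_sym.
have nec : e != c by rewrite eq_sym.
have neb : e != b by rewrite eq_sym.
apply: (@M3_in_lattice _ _ a b c e (b `|` e)); rewrite ?covers_lt ?meet //.
  by apply: covers_eq (cov b c _ _ _) (cov b e _ _ _) _; rewrite // leUx leUl.
rewrite joinC; apply: covers_eq (cov e c _ _ _) _ _ => //.
  by rewrite joinC; apply: cov.
by rewrite leUx leUr.
Qed.

Lemma at_most_two_covers d (L : finLatticeType d) (R : realType) (a b c e : L) :
  SPS R L -> covers a b -> covers a c -> covers a e ->
  b != c -> b != e -> c != e -> False.
Proof.
case=> slimL [p dp] sm ab ac ae nbc nbe nce.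
have ncb : c != b by rewrite eq_sym.
have neb : e != b by rewrite eq_sym.
have nec : e != c by rewrite eq_sym.
have up x y : covers x y -> ((p x).2 < (p y).2)%R by case: dp => _ + _; apply.
(* A horizontal line at height [h] crosses all three edges above [a], which orders them from left to
   right. *)
have [h [ah hb hc he]] : exists h, [/\ ((p a).2 < h)%R, (h <= (p b).2)%R,
    (h <= (p c).2)%R & (h <= (p e).2)%R].
  exists (Num.min (p b).2 (Num.min (p c).2 (p e).2)).
  by rewrite !lt_min !ge_min !up ?lexx ?orbT.
have mid x y z : covers a x -> covers a y -> covers a z ->
    x != y -> x != z -> y != z ->
    (h <= (p x).2)%R -> (h <= (p y).2)%R -> (h <= (p z).2)%R ->
    (xat (p a) (p x) h < xat (p a) (p y) h)%R ->
    (xat (p a) (p y) h < xat (p a) (p z) h)%R -> False.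
  move=> ax ay az nxy nxz nyz hx hy hz xy yz.
  apply/slimL/(M3_of_three_covers sm ax ay az) => //.
  exact: middle_cover_le xy yz.
have ne x y : covers a x -> covers a y -> x != y ->
    (h <= (p x).2)%R -> (h <= (p y).2)%R ->
    (xat (p a) (p x) h < xat (p a) (p y) h)%R \/
    (xat (p a) (p y) h < xat (p a) (p x) h)%R.
  move=> ax ay nxy hx hy.
  have [| |E] := ltgtP (xat (p a) (p x) h) (xat (p a) (p y) h); [by left|by right|].
  case: (xat_meet dp ax ay _ _ _ E); rewrite ?hx ?hy ?(ltW ah) //.
    by apply: contra_neq nxy => -[].
  (* The shared vertex lies strictly higher than [a], so it is the upper end of both edges. *)
  move=> v [v1 v2 hv].
  have va : v != a by apply: contraTneq ah => <-; rewrite hv ltxx.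
  move: v1 v2; rewrite !inE (negbTE va) /= => /eqP-> /eqP xy.
  by rewrite xy eqxx in nxy.
have [bc|cb] := ne b c ab ac nbc hb hc; have [be|eb] := ne b e ab ae nbe hb he;
  have [ce|ec] := ne c e ac ae nce hc he.
- exact: (mid b c e).
- exact: (mid b e c).
- by lra.
- exact: (mid e b c).
- exact: (mid c b e).
- by lra.
- exact: (mid c e b).
- exact: (mid e c b).
Qed.

(* If neither [a] nor [b] is above [x] and they are incomparable, then covers of
   [a `&` b] below [a] and below [b], together with [x `|` (a `&` b)], are three
   covers of [a `&` b]. *)
Lemma cover_of_node_join_prime d (L : finLatticeType d) (R : realType) (m x : L) :
  SPS R L -> (forall a, (a <= m) || (m <= a)) -> covers m x -> join_prime x.
Proof.
move=> sps node mx a b; apply/idP/orP; last first.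
  by case=> /le_trans; apply; [apply: leUl | apply: leUr].
move=> xab; case: (boolP (x <= a)); [by left|move=> nxa].
case: (boolP (x <= b)); [by right|move=> nxb].
have nab : ~~ (a <= b) by apply: contraNN nxb => /join_idPr <-.
have nba : ~~ (b <= a) by apply: contraNN nxa => /join_idPl <-.
have nxm : ~~ (x <= m) by rewrite lt_geF ?covers_lt.
(* If [a <= m], then either [b <= m] and [x <= m] follows, or [m <= b] and [a <= b] follows. *)
have ma : m <= a.
  case/orP: (node a) => // am; case/orP: (node b) => [bm|mb].
    by case/negP: nxm; apply: le_trans xab _; rewrite leUx am bm.
  by rewrite (le_trans am mb) in nab.
have mb : m <= b.
  case/orP: (node b) => // bm; by rewrite (le_trans bm ma) in nba.
pose c := a `&` b.
have ca : c < a by rewrite lt_leAnge leIl lexI lexx.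
have cb : c < b by rewrite lt_leAnge leIr lexI lexx andbT.
have cx : covers c (x `|` c).
  case: sps => _ _ sm; apply: (semimodular_covers sm mx); first by rewrite lexI ma.
  by rewrite lexI (negbTE nxa).
have [[a' ca' a'a] [b' cb' b'b]] := (covers_below ca, covers_below cb).
exfalso; apply: (at_most_two_covers sps ca' cb' cx).
(* If [a'] and [b'] were equal, they would lie below [a] and [b], hence below [c]. *)
- apply: contraTneq (covers_lt ca') => e.
  by rewrite le_gtF // lexI a'a e b'b.
- by apply: contraNneq nxa => e; apply: le_trans a'a; rewrite e leUl.
- by apply: contraNneq nxb => e; apply: le_trans b'b; rewrite e leUl.
Qed.

Theorem mainTheorem1 (R : realType) (d : Order.disp_t) (L : finLatticeType d)
    (hL : SPS R L) (hcard : (2 < #|L|)%N) :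
  (2 <= #|[set theta : con L | dual_atom theta]|)%N.
Proof.
have /card_gt0P[x0 _] : (0 < #|L|)%N by apply: ltn_trans hcard.
have [o ole] := finLattice_bottom x0.
have jp := cover_of_node_join_prime hL.
have [y yo] : exists y : L, o < y.
  have /card_gt1P[u [v [_ _ uv]]] : (1 < #|L|)%N by apply: ltn_trans hcard.
  have [eu|nu] := eqVneq o u; [exists v | exists u]; rewrite lt_neqAle ole andbT //.
  by rewrite eu.
have [x ox _] := covers_below yo.
have px : join_prime x by apply: (jp o) => // a; rewrite ole orbT.
have nxo : ~~ (x <= o) by rewrite lt_geF ?covers_lt.
have [/existsP[z /andP[oz zx]]|uniq_atom] :=
  boolP [exists z, covers o z && (z != x)].
  have pz : join_prime z by apply: (jp o) => // a; rewrite ole orbT.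
  apply: (two_dual_atoms px pz nxo (q' := o)); last by rewrite eq_sym.
  by rewrite lt_geF ?covers_lt.
(* From here on [x] is the only atom, so it is comparable to every element. *)
have xle a : (a == o) || (x <= a).
  have [//|/= ao] := eqVneq a o.
  have [z oz za] : exists2 z, covers o z & z <= a.
    by apply: covers_below; rewrite lt_neqAle eq_sym ao ole.
  move: uniq_atom; rewrite negb_exists => /forallP/(_ z).
  by rewrite oz negbK => /eqP <-.
(* Otherwise [o] and [x] would be the only elements, against [hcard]. *)
have [w xw] : exists w, x < w.
  have [/existsP[w wx]|] := boolP [exists w : L, x < w]; first by exists w.
  rewrite negb_exists => /forallP nw; exfalso; move: hcard.
  have <- : #|[set o; x]| = 2%N by rewrite cards2 lt_eqF ?covers_lt.
  rewrite ltnNge => /negP; apply; apply: subset_leq_card.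
  apply/subsetP=> w _; rewrite !inE.
  case/orP: (xle w) => [->//|]; rewrite le_eqVlt eq_sym (negbTE (nw w)) orbF => ->.
  by rewrite orbT.
have [z xz _] := covers_below xw.
have pz : join_prime z.
  by apply: (jp x) => // a; case/orP: (xle a) => [/eqP->|->]; rewrite ?ole ?orbT.
apply: (two_dual_atoms px pz nxo (q' := x)).
  by rewrite lt_geF ?covers_lt.
by rewrite lt_eqF ?covers_lt.
Qed.
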